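(* Let $V$ be a finite ground set, $f:2^V\to\mathbb{R}_{\ge0}$ a normalized monotone submodular function, $g:2^V\to\mathbb{R}_{\ge0}$ a normalized monotone supermodular function with supermodular curvature $\gamma$, and $\theta>0$. Let $S^*$ be an optimal solution of $\max\{f(S): S\subseteq V,\ g(S)\le\theta\}$, and let $S_0\subseteq S_1\subseteq\cdots$ be the sets produced by the Greedy-Ratio-Marginal algorithm. Suppose that $g(S_{k-1})\le\theta$ and that $g(S_k)>\theta$, and set $\beta=g(S_k)/\theta>1$. Then at least one of the following holds: (i) $f(S_{k-1})\ge \left(1-e^{-(1-\gamma)}\right) f(S^* )$; (ii) $f(S_k)\ge \left(1-e^{-\beta(1-\gamma)}\right)f(S^* )$.
   Context: A function $f$ is normalized if $f(\emptyset)=0$; monotone if $f(A)\le f(B)$ for $A\subseteq B$; submodular if $f(A\cup\{e\})-f(A)\ge f(B\cup\{e\})-f(B)$ for all $A\subseteq B\subseteq V$, $e\in V\setminus B$; supermodular if the reverse inequality holds. Marginals: $g(T\mid S)=g(T\cup S)-g(S)$, $f(v\mid S)=f(S\cup\{v\})-f(S)$, and $g(v)=g(\{v\})$. The supermodular curvature of $g$ is $\gamma = 1-\min_{S,T\subseteq V:\ g(T)\ge g(S)} \frac{g(T)}{g(T\mid S)}\in[0,1]$. The Greedy-Ratio-Marginal algorithm starts from $S_0=\emptyset$ and for $i=0,1,2,\dots$ chooses $v_{i+1}\in\arg\max_{v\notin S_i}\frac{f(v\mid S_i)}{g(v\mid S_i)}$ and sets $S_{i+1}=S_i\cup\{v_{i+1}\}$.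 *)

(* Defs.v *)
From HB Require Import structures.
From mathcomp Require Import all_boot all_order all_algebra.
From mathcomp Require Import constructive_ereal reals.

Set Implicit Arguments.
Unset Strict Implicit.
Unset Printing Implicit Defensive.

Import Order.TTheory GRing.Theory Num.Theory.
Local Open Scope ring_scope.

Definition normalized (R : realType) (V : finType) (h : {set V} -> R) : Prop :=
  h set0 = 0.

Definition monotone (R : realType) (V : finType) (h : {set V} -> R) : Prop :=
  forall A B : {set V}, A \subset B -> h A <= h B.

(* [marginal h T S] is h(T | S): the conditioning set comes last *)
Definition marginal (R : realType) (V : finType) (h : {set V} -> R)
    (T S : {set V}) : R :=
  h (T :|: S) - h S.

Definition submodular (R : realType) (V : finType) (h : {set V} -> R) : Prop :=
  forall (A B : {set V}) (e : V), A \subset B -> e \notin B ->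
    h (A :|: [set e]) - h A >= h (B :|: [set e]) - h B.

Definition supermodular (R : realType) (V : finType) (h : {set V} -> R) : Prop :=
  forall (A B : {set V}) (e : V), A \subset B -> e \notin B ->
    h (A :|: [set e]) - h A <= h (B :|: [set e]) - h B.

(* Pairs with g(T | S) = 0 (such as S = T) are left out: g(T) / 0 is read as
   +oo, or as 1 when g(T) = 0, whereas [x / 0 = 0] in a field would force the
   minimum to be 0. The default value 1 of the iterated minimum does not alter
   it: if g is normalized, monotone and not identically 0, then S = set0 and
   T = setT give the ratio 1. *)
Definition supermodular_curvature (R : realType) (V : finType)
    (g : {set V} -> R) : R :=
  1 - \big[Order.min/1]_(p : {set V} * {set V} |
                          (g p.1 <= g p.2) && (marginal g p.2 p.1 != 0))
        (g p.2 / marginal g p.2 p.1).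

(* The quotient is taken in the extended reals, where a / 0 = +oo for a > 0
   and 0 / 0 = 0: an element that improves f at no cost comes first. *)
Definition marginal_ratio (R : realType) (V : finType) (f g : {set V} -> R)
    (S : {set V}) (v : V) : \bar R :=
  ((marginal f [set v] S)%:E / (marginal g [set v] S)%:E)%E.

(* S 0, ..., S k are the sets of the first k rounds of Greedy-Ratio-Marginal,
   for some way of breaking ties; values of S beyond k are irrelevant. *)
Definition greedy_ratio_marginal (R : realType) (V : finType)
    (f g : {set V} -> R) (S : nat -> {set V}) (k : nat) : Prop :=
  S 0%N = set0 /\
  forall i : nat, (i < k)%N -> exists v : V,
    [/\ v \notin S i,
        forall u : V, u \notin S i ->
          (marginal_ratio f g (S i) u <= marginal_ratio f g (S i) v)%E
      & S i.+1 = S i :|: [set v]].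

Definition optimal_solution (R : realType) (V : finType) (f g : {set V} -> R)
    (theta : R) (A : {set V}) : Prop :=
  g A <= theta /\ forall B : {set V}, g B <= theta -> f B <= f A.

(* Main.v *)
(** Write [c = 1 - gamma] and let [v] be the element chosen at [S_i]. The greedy
    choice makes [f(v|S_i) g - g(v|S_i) f], a supermodular function, have
    nonnegative singleton marginals at [S_i], hence a nonnegative marginal for
    [S*]. If [g(S_i) <= g(S* )], the curvature gives [c g(S*|S_i) <= g(S* )], so
    for every [G >= g(S* )] the gap [f(S* ) - f(S_i)] shrinks in round [i] by a
    factor at most [1 - c g(v|S_i) / G <= exp(- c g(v|S_i) / G)]. Let [m] be the
    first index with [g(S_m) > g(S* )]. For [m = k], taking [G = theta] gives
    (ii); for [m < k], taking [G = g(S_m)] gives (i). *)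

Require Import Defs.
From HB Require Import structures.
From mathcomp Require Import all_boot all_order all_algebra.
From mathcomp Require Import constructive_ereal reals.
From mathcomp Require Import sequences exp.
From mathcomp Require Import ring lra.

Import Order.TTheory GRing.Theory Num.Theory.
Local Open Scope ring_scope.

Lemma marginal_ge0 {R : realType} {V : finType} (h : {set V} -> R)
    (T S : {set V}) :
  monotone h -> 0 <= marginal h T S.
Proof. by move=> hm; rewrite subr_ge0 hm ?subsetUr. Qed.

Lemma supermodular_curvature_le1 {R : realType} {V : finType}
    (g : {set V} -> R) :
  (forall A, 0 <= g A) -> monotone g -> supermodular_curvature g <= 1.
Proof.
move=> g0 gm; rewrite lerBlDr lerDl.
elim/big_ind: _ => // [x y x0 y0|p _]; first by rewrite le_min x0.
by rewrite divr_ge0 ?marginal_ge0.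
Qed.

(** When the marginal is nonzero, [(S, T)] is one of the pairs the minimum ranges over. A zero
    marginal, excluded from the minimum, leaves only [0 <= g T]. *)
Lemma supermodular_curvature_marginal {R : realType} {V : finType}
    (g : {set V} -> R) (S T : {set V}) :
  (forall A, 0 <= g A) -> monotone g -> g S <= g T ->
  (1 - supermodular_curvature g) * marginal g T S <= g T.
Proof.
move=> g0 gm gST; have [->|m0] := eqVneq (marginal g T S) 0.
  by rewrite mulr0.
have mp : 0 < marginal g T S by rewrite lt_def m0 marginal_ge0.
rewrite -ler_pdivlMr // /supermodular_curvature opprB addrC subrK.
by rewrite (bigD1 (S, T)) /= ?gST ?m0 // ge_min lexx.
Qed.

(** Add the elements of [A] to [S] one at a time: by supermodularity each new element gains at least
    its marginal at [S]. *)
Lemma supermodular_ge_setU {R : realType} {V : finType} (h : {set V} -> R)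
    (A S : {set V}) :
  supermodular h -> (forall u, u \notin S -> 0 <= marginal h [set u] S) ->
  h S <= h (A :|: S).
Proof.
move=> hs hS; move: {2}#|A| (leqnn #|A|) => n.
elim: n A => [|n IH] A; first by rewrite leqn0 cards_eq0 => /eqP ->; rewrite set0U.
have [->|[u uA]] := set_0Vmem A; first by rewrite set0U.
rewrite (cardsD1 u) uA add1n ltnS => /IH /le_trans; apply.
have -> : A :|: S = (A :\ u :|: S) :|: [set u].
  by rewrite -{1}(setD1K uA) -setUA setUC.
have [uS|uS] := boolP (u \in A :\ u :|: S).
  by rewrite (setUidPl (_ : [set u] \subset _)) ?sub1set ?lexx.
rewrite -subr_ge0; apply: le_trans (hs S _ u (subsetUr _ _) uS).
by rewrite setUC; apply: hS; apply: contraNN uS; rewrite inE orbC => ->.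
Qed.

(** Clears the denominators of the greedy comparison, so that the later arguments stay in [R] even
    when a marginal of [g] vanishes. *)
Lemma marginal_ratio_le_cross {R : realType} {V : finType}
    (f g : {set V} -> R) (S : {set V}) (u v : V) :
  monotone f -> monotone g ->
  (marginal_ratio f g S u <= marginal_ratio f g S v)%E ->
  marginal g [set v] S * marginal f [set u] S <=
  marginal f [set v] S * marginal g [set u] S.
Proof.
move=> fm gm; rewrite /marginal_ratio.
have := marginal_ge0 _ [set u] S fm; have := marginal_ge0 _ [set v] S fm.
have := marginal_ge0 _ [set u] S gm; have := marginal_ge0 _ [set v] S gm.
move: (marginal f [set v] S) (marginal f [set u] S).
move: (marginal g [set v] S) (marginal g [set u] S) => gv gu fv fu.
rewrite le_eqVlt => /predU1P[<- gu0 fv0 _ _|gv0 gu0 fv0 fu0].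
  by rewrite mul0r mulr_ge0.
(* The ratio of [v] is now finite. If [gu = 0], then [fu > 0] would make the ratio of [u] infinite,
   so [fu = 0]. *)
rewrite (inver gv) gt_eqF // inver; case: eqP => [->|/eqP gu_neq0].
  move: fu0; rewrite le_eqVlt => /predU1P[<- _|fu0]; first by rewrite !mulr0.
  by rewrite gt0_muley ?lte_fin // -EFinM leye_eq.
have gu_gt0 : 0 < gu by rewrite lt_def gu_neq0.
by rewrite -!EFinM lee_fin ler_pdivrMr // mulrAC ler_pdivlMr // mulrC.
Qed.

Lemma greedy_marginal_le {R : realType} {V : finType} (f g : {set V} -> R)
    (A S : {set V}) (v : V) :
  monotone f -> submodular f -> monotone g -> supermodular g ->
  (forall u, u \notin S ->
    (marginal_ratio f g S u <= marginal_ratio f g S v)%E) ->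
  marginal g [set v] S * marginal f A S <=
  marginal f [set v] S * marginal g A S.
Proof.
move=> fm fs gm gs vmax.
have fv0 := marginal_ge0 _ [set v] S fm; have gv0 := marginal_ge0 _ [set v] S gm.
set a := marginal f [set v] S in fv0 *.
set b := marginal g [set v] S in gv0 *.
pose h B := a * g B - b * f B.
have hs : supermodular h.
  move=> X Y e XY eY.
  have := ler_wpM2l fv0 (gs _ _ _ XY eY); have := ler_wpM2l gv0 (fs _ _ _ XY eY).
  by rewrite /h; lra.
have hS u : u \notin S -> 0 <= marginal h [set u] S.
  move=> /vmax /(marginal_ratio_le_cross _ _ _ _ _ fm gm).
  by rewrite -/a -/b /marginal /h; lra.
by have := supermodular_ge_setU _ A S hs hS; rewrite /h /marginal; lra.
Qed.

(** A discrete Gronwall inequality: each step multiplies [D] by at most [1 - x <= expR (- x)], with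
    [x] the increment of [w], and the increments telescope. *)
Lemma gap_le_expR {R : realType} (D w : nat -> R) (n : nat) :
  0 <= D 0%N ->
  (forall i, (i < n)%N -> D i.+1 <= D i) ->
  (forall i, (i < n)%N -> (w i.+1 - w i) * D i <= D i - D i.+1) ->
  D n <= expR (- (w n - w 0%N)) * D 0%N.
Proof.
move=> D0; elim: n => [|n IH] Dmono Dstep.
  by rewrite subrr oppr0 expR0 mul1r.
have /IH {}IH i : (i < n)%N -> D i.+1 <= D i by move/ltnW/Dmono.
have {}IH := IH (fun i lin => Dstep i (ltnW lin)).
(* Multiplying [1 - x <= expR (- x)] by [D n] needs [D n] nonnegative; otherwise
   [D n.+1 <= D n <= 0] already suffices. *)
have [Dn0|Dn0] := leP (D n) 0.
  rewrite (le_trans (Dmono n _)) // (le_trans Dn0) //.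
  by rewrite mulr_ge0 ?expR_ge0.
have -> : - (w n.+1 - w 0%N) = - (w n.+1 - w n) - (w n - w 0%N) by lra.
rewrite expRD -mulrA.
have le1 : D n.+1 <= (1 - (w n.+1 - w n)) * D n by have := Dstep n (ltnSn n); lra.
apply: (le_trans le1); apply: le_trans (ler_wpM2l (expR_ge0 _) IH).
by rewrite ler_wpM2r ?expR_ge1Dx // ltW.
Qed.

Lemma greedy_prefix_bound {R : realType} {V : finType} (f g : {set V} -> R)
    (A : {set V}) (S : nat -> {set V}) (m : nat) (G : R) :
  (forall B, 0 <= f B) -> normalized f -> monotone f -> submodular f ->
  (forall B, 0 <= g B) -> normalized g -> monotone g -> supermodular g ->
  greedy_ratio_marginal f g S m ->
  (forall i, (i < m)%N -> g (S i) <= g A) -> 0 < G -> g A <= G ->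
  f (S m) >=
    (1 - expR (- (g (S m) / G * (1 - supermodular_curvature g)))) * f A.
Proof.
move=> f0 fn fm fs g0 gn gm gs [S0 Sstep] SA G0 AG.
set c := 1 - supermodular_curvature g.
have c0 : 0 <= c by rewrite subr_ge0 supermodular_curvature_le1.
have := @gap_le_expR R (fun i => f A - f (S i)) (fun i => g (S i) / G * c) m.
rewrite S0 fn gn mul0r mul0r !subr0 => gap.
suff : f A - f (S m) <= expR (- (g (S m) / G * c)) * f A by lra.
apply: gap => // i im; have [v [vS vmax ->]] := Sstep i im.
  by rewrite lerD2l lerN2 fm ?subsetUl.
have := greedy_marginal_le _ _ A _ _ fm fs gm gs vmax.
have := supermodular_curvature_marginal _ _ _ g0 gm (SA i im); rewrite -/c.
have := marginal_ge0 _ [set v] (S i) fm; have := marginal_ge0 _ [set v] (S i) gm.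
have fA : f A - f (S i) <= marginal f A (S i) by rewrite lerD2r fm ?subsetUl.
set dg := marginal g [set v] _; set df := marginal f [set v] _.
move=> dg0 df0 cA cross.
have -> : (g (S i :|: [set v]) / G * c - g (S i) / G * c) = c * dg / G.
  by rewrite /dg /marginal [_ :|: S i]setUC; ring.
have -> : f A - f (S i) - (f A - f (S i :|: [set v])) = df.
  by rewrite /df /marginal [_ :|: S i]setUC; ring.
(* With [D] the gap [f A - f (S i)], the chain is [c * dg * D <= c * df * marginal g A (S i) <= df *
   g A <= df * G]. *)
rewrite mulrAC ler_pdivrMr // -mulrA.
apply: (le_trans (ler_wpM2l c0 (le_trans (ler_wpM2l dg0 fA) cross))).
by rewrite mulrCA ler_wpM2l // (le_trans cA).
Qed.

Theorem mainTheorem2 (R : realType) (V : finType) (f g : {set V} -> R)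
    (theta : R) (Sstar : {set V}) (S : nat -> {set V}) (k : nat)
    (f_ge0 : forall A : {set V}, 0 <= f A)
    (f_norm : normalized f) (f_mono : monotone f) (f_sub : submodular f)
    (g_ge0 : forall A : {set V}, 0 <= g A)
    (g_norm : normalized g) (g_mono : monotone g) (g_super : supermodular g)
    (theta_gt0 : 0 < theta)
    (Sstar_opt : optimal_solution f g theta Sstar)
    (S_greedy : greedy_ratio_marginal f g S k)
    (k_gt0 : (0 < k)%N)
    (g_prev : g (S k.-1) <= theta)
    (g_last : theta < g (S k)) :
  let gamma := supermodular_curvature g in
  let beta := g (S k) / theta in
  f (S k.-1) >= (1 - expR (- (1 - gamma))) * f Sstar \/
  f (S k) >= (1 - expR (- (beta * (1 - gamma)))) * f Sstar.
Proof.
move=> gamma beta; have [Astar _] := Sstar_opt.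
have ex_m : exists m, g Sstar < g (S m) by exists k; apply: le_lt_trans g_last.
case: (ex_minnP ex_m) => m Sm m_min.
have m_le_k : (m <= k)%N by apply: m_min; apply: le_lt_trans g_last.
have SA i : (i < m)%N -> g (S i) <= g Sstar.
  by move=> im; rewrite leNgt; apply: contraL im => /m_min; rewrite -leqNgt.
have [S0 Sstep] := S_greedy.
have S_greedy_m : greedy_ratio_marginal f g S m.
  by split=> // i im; apply: Sstep; apply: leq_trans m_le_k.
have bound G := greedy_prefix_bound _ _ _ _ _ G f_ge0 f_norm f_mono f_sub g_ge0
  g_norm g_mono g_super S_greedy_m SA.
have [mk|mk] := eqVneq m k.
  by right; rewrite /beta -mk; apply: bound.
left; have Sm0 : 0 < g (S m) by apply: le_lt_trans Sm.
have := bound _ Sm0 (ltW Sm); rewrite divff ?gt_eqF // mul1r -/gamma.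
move=> /le_trans; apply; apply: f_mono.
have mk1 : (m <= k.-1)%N by rewrite -ltnS prednK // ltn_neqAle mk.
(* The bound [n <= k] matters: [S] is arbitrary beyond index [k]. *)
have S_mono n : (m <= n)%N -> (n <= k)%N -> S m \subset S n.
  elim: n => [|n IH]; first by rewrite leqn0 => /eqP ->.
  rewrite leq_eqVlt => /predU1P[->//|]; rewrite ltnS => mn nk.
  have [v [_ _ ->]] := Sstep n nk.
  by apply: subset_trans (subsetUl _ _); apply: IH => //; apply: ltnW.
by apply: S_mono => //; apply: leq_pred.
Qed.
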